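(* Let $\lambda$ be a nonzero real number and let $F_{n,\lambda}(x)$ ($n\ge 0$) be the degenerate Fubini polynomials. Then for every integer $n\ge 0$, $$F_{n+1,\lambda}(x)=x\sum_{k=0}^{n}\binom{n}{k}(1-\lambda)_{n-k,\lambda}\Big(F_{k,\lambda}(x)+xF_{k,\lambda}^{\prime}(x)\Big),$$ where $F_{k,\lambda}^{\prime}(x)=\frac{d}{dx}F_{k,\lambda}(x)$.
   Context: For a nonzero real number $\lambda$: generalized falling factorials $(x)_{0,\lambda}=1$, $(x)_{n,\lambda}=x(x-\lambda)\cdots(x-(n-1)\lambda)$ for $n\ge 1$. With $(x)_0=1$ and $(x)_n=x(x-1)\cdots(x-n+1)$ for $n\ge 1$, the degenerate Stirling numbers of the second kind ${n \brace k}_{\lambda}$ ($0\le k\le n$) are defined by the polynomial identity $(x)_{n,\lambda}=\sum_{k=0}^{n}{n \brace k}_{\lambda}(x)_{k}$, $n\ge 0$. The degenerate Fubini polynomials are $F_{n,\lambda}(x)=\sum_{k=0}^{n}{n \brace k}_{\lambda}k!\,x^{k}$. *)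

(* Defs.v *)
From HB Require Import structures.
From mathcomp Require Import all_boot all_order all_algebra.
From mathcomp Require Import reals.

Set Implicit Arguments.
Unset Strict Implicit.
Unset Printing Implicit Defensive.

Import Order.TTheory GRing.Theory Num.Theory.
Local Open Scope ring_scope.

(* Both factorials are defined over any commutative ring, so that they apply
   to numbers as well as to the indeterminate 'X (with l%:P for the step). *)
Definition dfalling (A : comNzRingType) (l x : A) (n : nat) : A :=
  \prod_(i < n) (x - l *+ i).

Definition falling (A : comNzRingType) (x : A) (n : nat) : A :=
  \prod_(i < n) (x - i%:R).

Definition is_degStirling2_row (R : realType) (l : R) (n : nat)
    (c : {ffun 'I_n.+1 -> R}) : bool :=
  dfalling l%:P 'X n == \sum_(k < n.+1) c k *: falling 'X k.

Lemma size_falling (R : realType) k : size (falling ('X : {poly R}) k) = k.+1.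
Proof.
rewrite /falling (eq_bigr (fun i : 'I_k => 'X - (i%:R)%:P)); last first.
  by move=> i _; rewrite polyC_natr.
by rewrite size_prod_XsubC /index_enum -enumT size_enum_ord.
Qed.

Lemma monic_falling (R : realType) k : falling ('X : {poly R}) k \is monic.
Proof.
by apply: rpred_prod => i _; rewrite -polyC_natr; apply: monicXsubC.
Qed.

Lemma size_dfalling (R : realType) (l : R) n :
  size (dfalling l%:P 'X n) = n.+1.
Proof.
rewrite /dfalling (eq_bigr (fun i : 'I_n => 'X - (l *+ i)%:P)); last first.
  by move=> i _; rewrite polyCMn.
by rewrite size_prod_XsubC /index_enum -enumT size_enum_ord.
Qed.

Lemma falling_span (R : realType) n (p : {poly R}) : (size p <= n)%N ->
  exists c : nat -> R, p = \sum_(k < n) c k *: falling 'X k.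
Proof.
elim: n p => [|n IH] p sp.
  by exists (fun=> 0); rewrite big_ord0; apply/eqP; rewrite -size_poly_eq0 -leqn0.
have [|c pE] := IH (p - p`_n *: falling 'X n).
  apply/leq_sizeP => j; rewrite leq_eqVlt => /orP[/eqP <-|nj].
    rewrite coefB coefZ.
    have /monicP := monic_falling R n.
    by rewrite lead_coefE size_falling /= => ->; rewrite mulr1 subrr.
  rewrite coefB coefZ (nth_default _ (leq_trans sp nj)).
  by rewrite [X in _ * X]nth_default ?mulr0 ?subrr // size_falling.
exists (fun k => if k == n then p`_n else c k).
rewrite big_ord_recr /= eqxx.
rewrite (eq_bigr (fun k : 'I_n => c k *: falling 'X k)) => [|k _].
  by rewrite -pE subrK.
by rewrite ltn_eqF.
Qed.

Lemma falling_free (R : realType) n (c : nat -> R) :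
  \sum_(k < n) c k *: falling ('X : {poly R}) k = 0 ->
  forall k, (k < n)%N -> c k = 0.
Proof.
elim: n => [//|n IH] s0.
have cn0 : c n = 0.
  have := congr1 (fun p : {poly R} => p`_n) s0.
  rewrite /= coef0 big_ord_recr /= coefD coefZ coef_sum big1 => [|i _].
    have /monicP := monic_falling R n.
    by rewrite lead_coefE size_falling /= => ->; rewrite mulr1 add0r.
  by rewrite coefZ nth_default ?mulr0 // size_falling ltn_ord.
move: s0; rewrite big_ord_recr /= cn0 scale0r addr0 => /IH ck0 k.
by rewrite ltnS leq_eqVlt => /orP[/eqP ->|/ck0].
Qed.

Lemma degStirling2_row_exists (R : realType) (l : R) (n : nat) :
  exists c : {ffun 'I_n.+1 -> R}, is_degStirling2_row l c.
Proof.
have [|c cE] := @falling_span R n.+1 (dfalling l%:P 'X n).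
  by rewrite size_dfalling.
exists [ffun k : 'I_n.+1 => c k]; apply/eqP; rewrite cE.
by apply: eq_bigr => k _; rewrite ffunE.
Qed.

(* The row k |-> {n \brace k}_l, 0 <= k <= n, is the family of coefficients in
   the defining identity; degStirling2_unique shows there is only one. *)
Definition degStirling2 (R : realType) (l : R) (n : nat) :
    {ffun 'I_n.+1 -> R} :=
  xchoose (degStirling2_row_exists l n).

Lemma degStirling2E (R : realType) (l : R) (n : nat) :
  dfalling l%:P 'X n = \sum_(k < n.+1) degStirling2 l n k *: falling 'X k.
Proof. exact: (eqP (xchooseP (degStirling2_row_exists l n))). Qed.

Lemma degStirling2_unique (R : realType) (l : R) (n : nat)
    (c : {ffun 'I_n.+1 -> R}) :
  is_degStirling2_row l c -> c = degStirling2 l n.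
Proof.
rewrite /is_degStirling2_row degStirling2E => /eqP cE; apply/ffunP => k.
pose d (j : nat) := degStirling2 l n (inord j) - c (inord j).
have d0 : \sum_(j < n.+1) d j *: falling ('X : {poly R}) j = 0.
  rewrite (eq_bigr (fun j : 'I_n.+1 => degStirling2 l n j *: falling 'X j
    - c j *: falling 'X j)) => [|j _].
    by rewrite sumrB cE subrr.
  by rewrite /d inord_val scalerBl.
have /eqP := falling_free d0 (ltn_ord k).
by rewrite /d inord_val subr_eq0 => /eqP.
Qed.

Definition degFubini (R : realType) (l : R) (n : nat) : {poly R} :=
  \sum_(k < n.+1) (degStirling2 l n k * k`!%:R) *: 'X^k.

(* Main.v *)
Require Import Defs.
From HB Require Import structures.
From mathcomp Require Import all_boot all_order all_algebra.
From mathcomp Require Import reals.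
From mathcomp Require Import ring.

Set Implicit Arguments.
Unset Strict Implicit.
Unset Printing Implicit Defensive.

Import Order.TTheory GRing.Theory Num.Theory.
Local Open Scope ring_scope.

(** The proof is umbral. Let [umbra] be the linear map of polynomials sending
    ['X^k] to [(X)_k / k!]; it is injective because the falling factorials are
    linearly independent, and by definition it sends [F_n] to [(X)_{n,l}]
    ([umbra_degFubini]), so the identity may be checked after applying it.
    Since [X * (X - 1)_k = (X)_{k+1}], the operator [q |-> X (q + X q')] on
    the Fubini side, which maps ['X^k] to [(k + 1) 'X^(k+1)], corresponds to
    [p |-> X * p(X - 1)] on the factorial side ([umbra_mulX_deriv]).
    The theorem thus becomes
      [(X)_{n+1,l} = X * sum_k 'C(n, k) (1 - l)_{n-k,l} (X - 1)_{k,l}],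
    which is [(X)_{n+1,l} = X * (X - l)_{n,l}] followed by the degenerate
    Vandermonde formula ([dfallingD]) for [X - l = (X - 1) + (1 - l)]. *)

Lemma dfallingS (A : comNzRingType) (l x : A) n :
  dfalling l x n.+1 = dfalling l x n * (x - l *+ n).
Proof. by rewrite /dfalling big_ord_recr. Qed.

Lemma dfallingSl (A : comNzRingType) (l x : A) n :
  dfalling l x n.+1 = x * dfalling l (x - l) n.
Proof.
rewrite /dfalling big_ord_recl mulr0n subr0; congr (_ * _).
by apply: eq_bigr => i _; rewrite /= /bump add1n mulrS opprD addrA.
Qed.

Lemma rmorph_dfalling (A B : comNzRingType) (f : {rmorphism A -> B})
    (l x : A) n : f (dfalling l x n) = dfalling (f l) (f x) n.
Proof.
by rewrite rmorph_prod; apply: eq_bigr => i _; rewrite rmorphB rmorphMn.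
Qed.

(** The degenerate Chu-Vandermonde convolution: the sequence [dfalling l] is
    of binomial type. *)
Lemma dfallingD (A : comNzRingType) (l x y : A) n :
  dfalling l (x + y) n =
  \sum_(k < n.+1) (dfalling l x k * dfalling l y (n - k)) *+ 'C(n, k).
Proof.
elim: n => [|n IHn].
  by rewrite big_ord_recl big_ord0 /dfalling !big_ord0 mulr1 addr0.
pose t k := dfalling l x k * dfalling l y (n.+1 - k).
(* x + y - n l = (x - k l) + (y - (n - k) l) raises either of the two factors *)
have -> : dfalling l (x + y) n.+1 =
    \sum_(k < n.+1) (t k.+1 *+ 'C(n, k) + t k *+ 'C(n, k)).
  rewrite dfallingS IHn big_distrl; apply: eq_bigr => -[k] /=.
  rewrite ltnS => le_kn _; rewrite -mulrnDl mulrnAl; congr (_ *+ _).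
  rewrite /t subSS subSn // !dfallingS -{2}(subnKC le_kn) mulrnDr.
  ring.
rewrite big_split /=.
rewrite [RHS]big_ord_recl bin0.
under [in RHS]eq_bigr => k _ do rewrite /= /bump add1n binS mulrnDr.
rewrite big_split /= addrA [RHS]addrC; congr (_ + _).
rewrite [in RHS]big_ord_recr /= bin_small // mulr0n addr0.
rewrite big_ord_recl bin0; congr (_ + _).
Qed.

Section Umbra.

Variable R : realType.
Implicit Types (p q : {poly R}) (l : R).

Lemma fact_neq0 n : n`!%:R != 0 :> R.
Proof. by rewrite pnatr_eq0 -lt0n fact_gt0. Qed.

(** The linear map ['X^k |-> (X)_k / k!], inverse to the map sending
    [(X)_k] to [k! 'X^k] that defines the degenerate Fubini polynomials. *)
Definition umbra q : {poly R} :=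
  \sum_(k < size q) (q`_k / k`!%:R) *: falling 'X k.

Lemma umbra_widen q n : (size q <= n)%N ->
  umbra q = \sum_(k < n) (q`_k / k`!%:R) *: falling 'X k.
Proof.
move=> le_qn; rewrite /umbra.
rewrite (big_ord_widen n (fun k => (q`_k / k`!%:R) *: falling 'X k)) //.
rewrite big_mkcond; apply: eq_bigr => k _; case: ltnP => // le_qk.
by rewrite nth_default // mul0r scale0r.
Qed.

Lemma umbra_is_linear : linear umbra.
Proof.
move=> a p q; pose n := maxn (size p) (size q).
have le_pn : (size p <= n)%N by apply: leq_maxl.
have le_qn : (size q <= n)%N by apply: leq_maxr.
have le_n : (size ((a *: p + q)%R : {poly R}) <= n)%N.
  rewrite (leq_trans (size_polyD _ _)) // geq_max le_qn andbT.
  exact: leq_trans (size_scale_leq _ _) le_pn.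
rewrite !(umbra_widen (n := n)) // scaler_sumr -big_split.
apply: eq_bigr => k _ /=.
by rewrite coefD coefZ mulrDl scalerDl scalerA mulrA.
Qed.

HB.instance Definition _ :=
  GRing.isLinear.Build R {poly R} {poly R} _ umbra umbra_is_linear.

Lemma umbraXn k : umbra 'X^k = k`!%:R^-1 *: falling 'X k.
Proof.
rewrite /umbra size_polyXn big_ord_recr /= big1 ?add0r => [|i _].
  by rewrite coefXn eqxx mul1r.
by rewrite coefXn ltn_eqF ?mul0r ?scale0r.
Qed.

Lemma umbra_inj : injective umbra.
Proof.
move=> p q /eqP; rewrite -subr_eq0 -raddfB => /eqP u0.
apply/eqP; rewrite -subr_eq0; apply/eqP/polyP => k; rewrite coef0.
have [lt_k|/(nth_default 0)//] := ltnP k (size (p - q)).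
have /eqP := falling_free (c := fun k => (p - q)`_k / k`!%:R) u0 lt_k.
by rewrite mulf_eq0 invr_eq0 (negbTE (fact_neq0 k)) orbF => /eqP.
Qed.

Lemma umbra_degFubini l n : umbra (degFubini l n) = dfalling l%:P 'X n.
Proof.
rewrite degStirling2E linear_sum; apply: eq_bigr => k _.
by rewrite linearZ /= umbraXn scalerA mulfK ?fact_neq0.
Qed.

Lemma fallingSl k :
  falling ('X : {poly R}) k.+1 = 'X * (falling 'X k \Po ('X - 1)).
Proof.
rewrite /falling big_ord_recl subr0 rmorph_prod; congr (_ * _).
apply: eq_bigr => i _; rewrite rmorphB /= comp_polyX rmorph_nat.
by rewrite /bump add1n mulrS opprD addrA.
Qed.

(** [q + X q'] is the derivative of [X q]; both sides are linear in [q], and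
    on ['X^k] they are [(X)_{k+1} / k!]. *)
Lemma umbra_mulX_deriv q :
  umbra ('X * (q + 'X * q^`())) = 'X * (umbra q \Po ('X - 1)).
Proof.
have -> : 'X * (q + 'X * q^`()) = \sum_(k < size q) (q`_k *+ k.+1) *: 'X^(k.+1).
  have -> : q + 'X * q^`() = ('X * q)^`() by rewrite derivM derivX mul1r.
  rewrite -{1}[q]coefK poly_def mulr_sumr raddf_sum mulr_sumr.
  apply: eq_bigr => k _.
  by rewrite -scalerAr -exprS /= derivZ derivXn -scalerAr mulrnAr -exprS
             -scalerMnr scalerMnl.
rewrite linear_sum /umbra (linear_sum (comp_poly _)) mulr_sumr.
apply: eq_bigr => k _ /=.
rewrite linearZ /= umbraXn comp_polyZ -scalerAr -fallingSl scalerA.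
congr (_ *: _); rewrite -[q`_k *+ _]mulr_natr factS natrM invfM mulrA.
by rewrite mulfK ?pnatr_eq0.
Qed.

End Umbra.

Theorem theorem2p14 (R : realType) (lambda : R) (hlambda : lambda != 0)
    (n : nat) :
  degFubini lambda n.+1 =
  'X * \sum_(k < n.+1)
         ('C(n, k)%:R * dfalling lambda (1 - lambda) (n - k)) *:
           (degFubini lambda k + 'X * (degFubini lambda k)^`()).
Proof.
apply: umbra_inj; rewrite umbra_degFubini mulr_sumr linear_sum dfallingSl.
have -> : 'X - lambda%:P = ('X - 1) + (1 - lambda)%:P.
  by rewrite polyCB addrA subrK.
rewrite dfallingD mulr_sumr; apply: eq_bigr => k _ /=.
rewrite -scalerAr linearZ /= umbra_mulX_deriv umbra_degFubini.
rewrite rmorph_dfalling /= comp_polyC comp_polyX -rmorph_dfalling /=.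
by rewrite -mul_polyC polyCM polyC_natr -mulr_natr; ring.
Qed.
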